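(* Every finite matroid of cyclic width at most $2$ is bitransversal.
   Context: A flat is cyclic if it is a (possibly empty) union of circuits; the cyclic width of $M$ is the maximum size of an antichain in the poset (under inclusion) of cyclic flats of $M$. A matroid is bitransversal if both it and its dual are transversal matroids. *)

(* Defs.v *)
From mathcomp Require Import all_boot.

Set Implicit Arguments.
Unset Strict Implicit.
Unset Printing Implicit Defensive.

(* A finite matroid whose ground set is the whole finite type T. *)
Record matroid (T : finType) := Matroid {
  indep : pred {set T};
  indep0 : indep set0;
  indepS : forall I J : {set T}, J \subset I -> indep I -> indep J;
  indep_aug : forall I J : {set T}, indep I -> indep J -> #|I| < #|J| ->
    exists2 x, x \in J :\: I & indep (x |: I)
}.

Section MatroidNotions.

Variables (T : finType) (M : matroid T).
Implicit Types (A B C F I : {set T}) (S : {set {set T}}).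

Definition basis B : bool := maxset (indep M) B.

Definition circuit C : bool := minset (fun A => ~~ indep M A) C.

Definition rank A : nat := \max_(I : {set T} | indep M I && (I \subset A)) #|I|.

Definition closure A : {set T} := [set x | rank (x |: A) == rank A].

Definition flat F : bool := closure F == F.

Definition cyclic F : bool :=
  [exists S : {set {set T}}, [forall C in S, circuit C] && (F == cover S)].

Definition cyclic_flats : {set {set T}} := [set F | flat F && cyclic F].

Definition antichain S : bool :=
  [forall A in S, forall B in S, (A \subset B) ==> (A == B)].

Definition cyclic_width : nat :=
  \max_(S : {set {set T}} | (S \subset cyclic_flats) && antichain S) #|S|.

(* The domain of the matching is the subtype of X, so that set0 is a partial
   transversal even of the empty family (k = 0). *)
Definition partial_transversal k (A : 'I_k -> {set T}) (X : {set T}) : Prop :=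
  exists2 f : {x : T | x \in X} -> 'I_k,
    injective f & forall x, val x \in A (f x).

Definition transversal_matroid : Prop :=
  exists k (A : 'I_k -> {set T}),
    forall X : {set T}, indep M X <-> partial_transversal A X.

Lemma basis_exists I : indep M I -> exists2 B, basis B & I \subset B.
Proof. by move=> /maxset_exists[B bB sIB]; exists B. Qed.

Lemma basis_indep B : basis B -> indep M B.
Proof. exact: maxsetp. Qed.

Lemma leq_card_basis I B : indep M I -> basis B -> #|I| <= #|B|.
Proof.
move=> iI bB; rewrite leqNgt; apply/negP => ltBI.
have [x] := indep_aug (basis_indep bB) iI ltBI.
rewrite inE => /andP[xB _] ixB.
have := maxsetsup bB ixB (subsetU1 x B) => eqB.
by rewrite -eqB setU11 in xB.
Qed.

Lemma card_basis B B' : basis B -> basis B' -> #|B| = #|B'|.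
Proof.
by move=> bB bB'; apply/eqP; rewrite eqn_leq !leq_card_basis // basis_indep.
Qed.

Lemma basis_extend I B : indep M I -> basis B ->
  exists B', [/\ basis B', I \subset B' & B' \subset I :|: B].
Proof.
move=> iI bB; pose P X := indep M X && (X \subset I :|: B).
have PI : P I by rewrite /P iI subsetUl.
have [X mX sIX] := maxset_exists PI.
have /andP[iX sX] := maxsetp mX.
have leBX : #|B| <= #|X|.
  rewrite leqNgt; apply/negP => ltXB.
  have [x] := indep_aug iX (basis_indep bB) ltXB.
  rewrite inE => /andP[xX xB] ixX.
  have PxX : P (x |: X) by rewrite /P ixX subUset sub1set inE xB orbT.
  by rewrite -(maxsetsup mX PxX (subsetU1 x X)) setU11 in xX.
have [B' bB' sXB'] := basis_exists iX.
have/eqP eqX : X == B' by rewrite eqEcard sXB' (card_basis bB' bB).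
by exists B'; rewrite -{2 3}eqX.
Qed.

(* Independence in the dual: contained in the complement of some basis. *)
Definition coindep I : bool := [exists B, basis B && [disjoint B & I]].

Lemma coindepP I : reflect (exists2 B, basis B & [disjoint B & I]) (coindep I).
Proof.
apply: (iffP existsP) => [[B /andP[]]|[B bB dB]]; first by exists B.
by exists B; rewrite bB.
Qed.

Lemma coindep0 : coindep set0.
Proof.
have [B bB _] := basis_exists (indep0 M).
by apply/coindepP; exists B; rewrite // -setI_eq0 setI0.
Qed.

Lemma coindepS I (J : {set T}) : J \subset I -> coindep I -> coindep J.
Proof.
move=> sJI /coindepP[B bB dB]; apply/coindepP; exists B => //.
exact: disjointWr sJI dB.
Qed.

Lemma coindep_aug I (J : {set T}) : coindep I -> coindep J -> #|I| < #|J| ->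
  exists2 x, x \in J :\: I & coindep (x |: I).
Proof.
move=> /coindepP[BI bBI dBI] /coindepP[BJ bBJ dBJ] ltIJ.
have iBJI : indep M (BJ :\: I) by rewrite (indepS _ (basis_indep bBJ)) ?subsetDl.
have [B [bB sB Bs]] := basis_extend iBJI bBI.
have dB : [disjoint B & I].
  apply: (disjointWl Bs); rewrite -setI_eq0 setIUl setU_eq0 !setI_eq0 dBI andbT.
  by rewrite -setI_eq0 setIC setIDA setIC setDIl setDv setI0.
have [sJB|/subsetPn[x xJI xB]] := boolP (J :\: I \subset B); last first.
  exists x => //; apply/coindepP; exists B => //.
  rewrite -setI_eq0 setIUr setU_eq0 !setI_eq0 dB andbT.
  by rewrite disjoint_sym disjoints1.
have dJ : [disjoint J :\: I & BJ :\: I].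
  by rewrite disjoint_sym; apply: disjointW dBJ; rewrite ?subsetDl.
exfalso.
have : #|(J :\: I) :|: (BJ :\: I)| <= #|B|.
  by rewrite subset_leq_card ?subUset ?sJB.
rewrite cardsU (eqP (_ : _ :&: _ == set0)) ?setI_eq0 // cards0 subn0.
rewrite (card_basis bB bBJ) -(cardsID I BJ) leq_add2r => leJI.
have sIJ : BJ :&: I \subset I :\: J.
  rewrite subsetD subsetIr /=; exact: (disjointWl (subsetIl _ _) dBJ).
have := leq_trans leJI (subset_leq_card sIJ).
rewrite -(leq_add2l #|I :&: J|) cardsID setIC cardsID.
by rewrite leqNgt ltIJ.
Qed.

Definition dual : matroid T := Matroid coindep0 coindepS coindep_aug.

End MatroidNotions.

Lemma basis_dual (T : finType) (M : matroid T) (B : {set T}) :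
  basis (dual M) B = basis M (~: B).
Proof.
apply/idP/idP => [mB|bB].
  have /coindepP[B' bB' dB'] := maxsetp mB.
  have iC : indep (dual M) (~: B').
    by apply/coindepP; exists B'; rewrite // -setI_eq0 setICr.
  have sB : B \subset ~: B' by rewrite -disjoints_subset disjoint_sym.
  by rewrite -(maxsetsup mB iC sB) setCK.
apply/maxsetP; split=> [|A /coindepP[B' bB' dB'] sBA].
  by apply/coindepP; exists (~: B); rewrite // -setI_eq0 setIC setICr.
have sA : A \subset ~: B' by rewrite -disjoints_subset disjoint_sym.
apply/eqP; rewrite eq_sym eqEcard sBA.
apply: leq_trans (subset_leq_card sA) _.
by rewrite [leqLHS]cardsCs setCK (card_basis bB' bB) -cardsCs.
Qed.

Definition bitransversal (T : finType) (M : matroid T) : Prop :=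
  transversal_matroid M /\ transversal_matroid (dual M).

(* Main.v *)
Require Import Defs.
From mathcomp Require Import all_boot.
From mathcomp Require Import zify.

(* fingraph also has a [closure]. *)
Import Defs.

(* If [s] is a list of cyclic flats in which exactly [r(M) - r(F)] entries
   contain [F], for every cyclic flat [F], then the complements of the entries
   present [M], by Hall's theorem, provided that at most [r(M) - r(J)] entries
   contain any given set [J].  In cyclic width 2, the entries containing [J]
   are those above [G] or above [H] for two cyclic flats [G] and [H], so by
   inclusion-exclusion their number is [r(M) - (r(G) + r(H) - r(G :|: H))],
   which is at most [r(M) - r(G :&: H)] by submodularity.  The same bound,
   with [J] a cyclic flat, allows the list to be built from the top of the
   lattice downwards.  Complementation exchanges the cyclic flats of [M] and of
   its dual, which therefore have the same cyclic width. *)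

Set Implicit Arguments.
Unset Strict Implicit.
Unset Printing Implicit Defensive.

(** * Hall's theorem *)

(* Rado's argument: if [N x] has two elements, then one of them can be deleted
   without violating Hall's condition. *)
Lemma hall_marriage (T I : finType) (i0 : I) (X : {set T}) (N : T -> {set I}) :
    (forall J : {set T}, J \subset X -> #|J| <= #|\bigcup_(x in J) N x|) ->
  exists2 f : T -> I, {in X, forall x, f x \in N x} & {in X &, injective f}.
Proof.
(* Induction on the total size of the candidate sets, which drops with each deletion. *)
have [n] := ubnP (\sum_(x in X) #|N x|); elim: n N => // n IHn N ltNn hallN.
have N_gt0 x : x \in X -> 0 < #|N x|.
  by move=> xX; have := hallN [set x]; rewrite sub1set big_set1 cards1; apply.
have [/existsP[x /andP[xX /card_gt1P[a [b [Na Nb neq_ab]]]]]|] :=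
    boolP [exists x in X, 1 < #|N x|]; last first.
  (* All candidate sets are singletons, so the choice is forced, and Hall's condition on pairs makes
     it injective. The default [i0] is used only outside [X]. *)
  rewrite negb_exists_in => /forall_inP N_le1.
  pose f x := odflt i0 [pick i in N x].
  have fN x : x \in X -> N x = [set f x].
    move=> xX; have /cards1P[i Ni] : #|N x| == 1.
      by rewrite eqn_leq N_gt0 // leqNgt N_le1.
    rewrite /f; case: pickP => [j|/(_ i)]; rewrite Ni inE ?eqxx //.
    by move/eqP->.
  exists f => [x xX|x y xX yX eqf]; first by rewrite fN ?set11.
  have /hallN : [set x; y] \subset X by rewrite subUset !sub1set xX.
  rewrite bigcup_setU !big_set1 !fN // eqf setUid cards1 cards2.
  by case: eqP.
pose del c y := if y == x then N x :\ c else N y.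
have del_sub c y : del c y \subset N y.
  by rewrite /del; case: eqP => // ->; rewrite subsetDl.
have deleted c : c \in N x ->
    (forall J : {set T}, J \subset X -> #|J| <= #|\bigcup_(y in J) del c y|) ->
    exists2 f : T -> I, {in X, forall x, f x \in N x} & {in X &, injective f}.
  move=> Nc hallD; have [||f fD injf] := IHn (del c); first 2 [by []].
    apply: leq_trans (ltNn : _ <= n); rewrite ![\sum_(_ in X) _](bigD1 x) //=.
    rewrite -addSn leq_add ?leq_sum // => [|y _].
      by rewrite /del eqxx [leqRHS](cardsD1 c) Nc.
    exact: subset_leq_card.
  by exists f => // y /fD; apply: subsetP.
(* Only the set of [x] shrinks, so a violating set must contain [x]. Here [J] is that set without
   [x], which turns the strict inequality into a weak one. *)
have violated c : ~ (forall J : {set T},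
      J \subset X -> #|J| <= #|\bigcup_(y in J) del c y|) ->
    exists2 J : {set T}, J \subset X :\ x
      & #|(\bigcup_(y in J) N y) :|: (N x :\ c)| <= #|J|.
  move=> hallDn; have /existsP[J /andP[sJX]] :
      [exists J : {set T}, (J \subset X)
         && (#|\bigcup_(y in J) del c y| < #|J|)].
    apply: contra_notT hallDn => /existsPn hJ J sJX.
    by have := hJ J; rewrite sJX -leqNgt.
  have delN y : y \in J :\ x -> del c y = N y.
    by rewrite !inE /del => /andP[/negPf->].
  have [xJ|xJ] := boolP (x \in J); last first.
    rewrite ltnNge (eq_bigr N) ?hallN // => y yJ.
    by rewrite delN // in_setD1 yJ andbT; apply: contraNneq xJ => <-.
  rewrite (cardsD1 x J) xJ ltnS => ltJ.
  exists (J :\ x); first exact: setSD.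
  apply: leq_trans ltJ; rewrite [in leqRHS](big_setD1 x) //= (eq_bigr _ delN).
  by rewrite setUC /del eqxx.
have [hallA|/forallPn[J hJ]] := boolP [forall J : {set T},
    (J \subset X) ==> (#|J| <= #|\bigcup_(y in J) del a y|)].
  by apply: (deleted a) => // J; apply/implyP/(forallP hallA).
have [J1 sJ1 leJ1] : exists2 J : {set T}, J \subset X :\ x
      & #|(\bigcup_(y in J) N y) :|: (N x :\ a)| <= #|J|.
  by apply: violated => h; case/negP: hJ; apply/implyP/h.
have [hallB|/forallPn[J' hJ']] := boolP [forall J : {set T},
    (J \subset X) ==> (#|J| <= #|\bigcup_(y in J) del b y|)].
  by apply: (deleted b) => // K; apply/implyP/(forallP hallB).
have [J2 sJ2 leJ2] : exists2 J : {set T}, J \subset X :\ x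
      & #|(\bigcup_(y in J) N y) :|: (N x :\ b)| <= #|J|.
  by apply: violated => h; case/negP: hJ'; apply/implyP/h.
exfalso; move: leJ1 leJ2.
set P := (_ :|: _); set Q := (\bigcup_(y in J2) _ :|: _) => leP leQ.
have sJU : J1 :|: J2 \subset X :\ x by rewrite subUset sJ1.
have xJU : x \notin J1 :|: J2.
  by apply/negP => /(subsetP sJU); rewrite !inE eqxx.
(* As [a] and [b] differ, [P :|: Q] contains all of [N x]. Hall's condition with [x] included then
   gives the extra unit that contradicts modularity of cardinality. *)
have leU : #|J1 :|: J2| < #|P :|: Q|.
  have /hallN : x |: (J1 :|: J2) \subset X.
    by rewrite subUset sub1set xX (subset_trans sJU) ?subsetDl.
  rewrite cardsU1 xJU => /leq_trans; apply; apply: subset_leq_card.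
  rewrite !bigcup_setU big_set1; apply/subsetP => i; rewrite !inE.
  case/orP => [Ni|/orP[]->]; rewrite ?orbT //.
  rewrite Ni !andbT; have [->|] := eqVneq i a; last by rewrite orbT.
  by rewrite neq_ab !orbT.
have leI : #|J1 :&: J2| <= #|P :&: Q|.
  have /hallN/leq_trans : J1 :&: J2 \subset X.
    by rewrite subIset // (subset_trans sJ1) ?subsetDl.
  apply; apply/subset_leq_card/bigcupsP => y; rewrite inE => /andP[yJ1 yJ2].
  rewrite subsetI /P /Q !subsetU //; apply/orP; left; exact: bigcup_sup.
have := cardsUI P Q; have := cardsUI J1 J2; lia.
Qed.

(** * Rank and cyclic flats *)

Section Rank.

Variables (T : finType) (M : matroid T).
Implicit Types (A B C F G H I J X Y : {set T}).

Lemma rank_geq I A : indep M I -> I \subset A -> #|I| <= rank M A.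
Proof.
move=> iI sIA; apply: (@leq_bigmax_cond _ _ (fun I : {set T} => #|I|) I).
by rewrite iI.
Qed.

Lemma rank_leq A n :
  (forall I, indep M I -> I \subset A -> #|I| <= n) -> rank M A <= n.
Proof. by move=> leAn; apply/bigmax_leqP => I /andP[]; apply: leAn. Qed.

Lemma rank_sub A B : A \subset B -> rank M A <= rank M B.
Proof.
move=> sAB; apply: rank_leq => I iI sIA.
exact: rank_geq iI (subset_trans sIA sAB).
Qed.

Lemma eq_rank_sub A B :
  A \subset B -> rank M B <= rank M A -> rank M A = rank M B.
Proof. by move=> sAB leBA; apply/eqP; rewrite eqn_leq rank_sub. Qed.

Lemma rank_card A : rank M A <= #|A|.
Proof. by apply: rank_leq => I _; apply: subset_leq_card. Qed.

Lemma indep_rank I : indep M I -> rank M I = #|I|.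
Proof. by move=> iI; apply/eqP; rewrite eqn_leq rank_card rank_geq. Qed.

Lemma rank_extend I A : indep M I -> I \subset A ->
  exists J, [/\ indep M J, I \subset J, J \subset A & #|J| = rank M A].
Proof.
move=> iI sIA; pose P X := indep M X && (X \subset A).
have PI : P I by rewrite /P iI.
have [J mJ sIJ] := maxset_exists PI.
have /andP[iJ sJA] := maxsetp mJ; exists J; split=> //.
apply/eqP; rewrite eqn_leq rank_geq //=; apply: rank_leq => K iK sKA.
rewrite leqNgt; apply/negP => /(indep_aug iJ iK)[x].
rewrite inE => /andP[xJ xK] ixJ.
have PxJ : P (x |: J) by rewrite /P ixJ subUset sub1set (subsetP sKA).
by rewrite -(maxsetsup mJ PxJ (subsetU1 x J)) setU11 in xJ.
Qed.

Lemma rank_witness A :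
  exists J, [/\ indep M J, J \subset A & #|J| = rank M A].
Proof.
by have [J [iJ _ sJA cJ]] := rank_extend (indep0 M) (sub0set A); exists J.
Qed.

(** A basis of [A :&: B] extends to a basis [J] of [A :|: B]; then [J :&: A] and [J :&: B] are
    independent, and modularity of cardinality concludes. *)
Lemma rank_submod A B :
  rank M (A :|: B) + rank M (A :&: B) <= rank M A + rank M B.
Proof.
have [I [iI sI cI]] := rank_witness (A :&: B).
have [|J [iJ sIJ sJ cJ]] := @rank_extend I (A :|: B) iI.
  by rewrite (subset_trans sI) // subIset // subsetUl.
have leA : #|J :&: A| <= rank M A.
  by rewrite rank_geq ?subsetIr // (indepS _ iJ) ?subsetIl.
have leB : #|J :&: B| <= rank M B.
  by rewrite rank_geq ?subsetIr // (indepS _ iJ) ?subsetIl.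
have := cardsUI (J :&: A) (J :&: B); rewrite -setIUr -setIIr (setIidPl sJ).
have : #|I| <= #|J :&: (A :&: B)| by rewrite subset_leq_card // subsetI sIJ.
lia.
Qed.

Lemma rank_setU1 x A : rank M (x |: A) <= (rank M A).+1.
Proof.
have := rank_submod [set x] A; have := rank_card [set x]; rewrite cards1; lia.
Qed.

Lemma rank_setU1_eq x A B :
  A \subset B -> rank M (x |: A) = rank M A -> rank M (x |: B) = rank M B.
Proof.
move=> sAB eqA; apply/esym/eq_rank_sub; first exact: subsetU1.
have := rank_submod (x |: A) B; rewrite -setUA (setUidPr sAB).
suff : rank M A <= rank M ((x |: A) :&: B) by lia.
by rewrite rank_sub // subsetI subsetU1.
Qed.

Lemma rank_setD1_eq x A B : A \subset B -> x \in A ->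
  rank M (A :\ x) = rank M A -> rank M (B :\ x) = rank M B.
Proof.
move=> sAB xA eqA; rewrite -{2}(setD1K (subsetP sAB x xA)).
by rewrite (rank_setU1_eq (setSD _ sAB)) // setD1K.
Qed.

(** * Closure and flats *)

Lemma closureP A x : reflect (rank M (x |: A) = rank M A) (x \in closure M A).
Proof. by rewrite inE; apply: eqP. Qed.

Lemma sub_closure A : A \subset closure M A.
Proof.
by apply/subsetP => x xA; apply/closureP; rewrite (setUidPr _) ?sub1set.
Qed.

Lemma rank_closure A : rank M (closure M A) = rank M A.
Proof.
apply/esym/eq_rank_sub; first exact: sub_closure.
have [I [iI sI <-]] := rank_witness (closure M A).
have [J [iJ sJA cJ]] := rank_witness A; rewrite -cJ leqNgt.
(* A larger independent set would augment [J] by a point of the closure, yet such a point does not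
   raise the rank of [A]. *)
apply/negP => /(indep_aug iJ iI)[x]; rewrite inE => /andP[xJ xI] ixJ.
have /closureP eqx := subsetP sI x xI.
have := rank_geq ixJ (setUS [set x] sJA).
by rewrite eqx -cJ cardsU1 xJ ltnn.
Qed.

Lemma flatP F :
  reflect (forall x, rank M (x |: F) = rank M F -> x \in F) (flat M F).
Proof.
apply: (iffP eqP) => [eqF x /closureP|flatF]; first by rewrite eqF.
apply/eqP; rewrite eqEsubset sub_closure andbT.
by apply/subsetP => x /closureP/flatF.
Qed.

Lemma closure_sub A F : flat M F -> (closure M A \subset F) = (A \subset F).
Proof.
move=> flatF; apply/idP/idP => [|sAF]; first exact/subset_trans/sub_closure.
apply/subsetP => x /closureP eqA; apply: (flatP F flatF).
exact: rank_setU1_eq eqA.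
Qed.

Lemma flat_closure A : flat M (closure M A).
Proof.
apply/flatP => x eqx; apply/closureP/esym/eq_rank_sub; first exact: subsetU1.
by rewrite -[leqRHS]rank_closure -eqx rank_sub // setUS ?sub_closure.
Qed.

(** * Circuits and cyclic flats *)

Lemma dependent_circuit A :
  ~~ indep M A -> exists2 C, circuit M C & C \subset A.
Proof.
move=> depA; have [C mC sCA] := @minset_exists _ (fun A => ~~ indep M A) A depA.
by exists C.
Qed.

Lemma circuit_setD1 C x : circuit M C -> x \in C -> indep M (C :\ x).
Proof.
move=> cC xC; apply/negPn/negP => dep.
have eqC := minsetinf cC dep (subsetDl C [set x]).
by rewrite -eqC setD11 in xC.
Qed.

Lemma circuit_rank C : circuit M C -> #|C| = (rank M C).+1.
Proof.
move=> cC; have depC := minsetp cC.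
have [I [iI sIC cI]] := rank_witness C; rewrite -cI.
have [x xC xI] : exists2 x, x \in C & x \notin I.
  by apply/subsetPn; apply: contra depC => /indepS; apply.
have := rank_geq (circuit_setD1 cC xC) (subsetDl C [set x]).
have : #|I| <= #|C :\ x| by rewrite subset_leq_card // subsetD1 sIC.
by rewrite (cardsD1 x C) xC; lia.
Qed.

(** Lying on a circuit inside [F] amounts to not being a coloop of the restriction to [F]. This rank
    form is the one that closure and duality can use. *)
Lemma cyclicP F :
  reflect {in F, forall x, rank M (F :\ x) = rank M F} (cyclic M F).
Proof.
apply: (iffP existsP) => [[S /andP[/forall_inP cS /eqP->]] x|cycF].
  case/bigcupP => C CS xC; apply: (rank_setD1_eq _ xC); first exact: bigcup_sup.
  have cC := cS C CS; rewrite (indep_rank (circuit_setD1 cC xC)).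
  by have := circuit_rank cC; rewrite (cardsD1 x) xC => -[].
exists [set C | circuit M C && (C \subset F)]; apply/andP; split.
  by apply/forall_inP => C; rewrite inE => /andP[].
rewrite eqEsubset; apply/andP; split; last first.
  by apply/bigcupsP => C; rewrite inE => /andP[].
apply/subsetP => x xF; have [I [iI sI cI]] := rank_witness (F :\ x).
have sxI : x |: I \subset F.
  by rewrite subUset sub1set xF (subset_trans sI) ?subsetDl.
have xI : x \notin I by apply/negP => /(subsetP sI); rewrite !inE eqxx.
(* [I] already has the rank of [F], so [x |: I] is dependent; since [I] is independent, the circuit
   found passes through [x]. *)
have /dependent_circuit[C cC sC] : ~~ indep M (x |: I).
  apply/negP => /rank_geq/(_ sxI).
  by rewrite cardsU1 xI cI cycF // ltnn.
apply/bigcupP; exists C; first by rewrite inE cC (subset_trans sC).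
apply: contraLR (minsetp cC) => xC; rewrite negbK (indepS _ iI) //.
by rewrite -(setU1K xI) subsetD1 sC.
Qed.

(** Points of [A] stay deletable in any larger set, and points added by the closure are deletable
    because [A] still spans. *)
Lemma cyclic_closure A :
    {in A, forall x, rank M (A :\ x) = rank M A} ->
  closure M A \in cyclic_flats M.
Proof.
move=> cycA; rewrite inE flat_closure; apply/cyclicP => x _.
have [xA|xA] := boolP (x \in A).
  exact: rank_setD1_eq (sub_closure A) xA (cycA x xA).
apply: eq_rank_sub; rewrite ?subsetDl // rank_closure.
by rewrite rank_sub // subsetD1 sub_closure.
Qed.

Lemma circuit_closure C : circuit M C -> closure M C \in cyclic_flats M.
Proof.
move=> cC; apply: cyclic_closure => x xC.
have := circuit_rank cC; rewrite (indep_rank (circuit_setD1 cC xC)).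
by rewrite (cardsD1 x) xC => -[].
Qed.

Lemma cyclic_flats_join F G : F \in cyclic_flats M -> G \in cyclic_flats M ->
  closure M (F :|: G) \in cyclic_flats M.
Proof.
rewrite 2!inE => /andP[_ /cyclicP cF] /andP[_ /cyclicP cG].
apply: cyclic_closure => x /setUP[xF|xG].
  exact: rank_setD1_eq (subsetUl F G) xF (cF x xF).
exact: rank_setD1_eq (subsetUr F G) xG (cG x xG).
Qed.

End Rank.

(** * Duality of rank and cyclic flats *)

(** The upper bound compares a coindependent [I] with a basis avoiding it; the lower bound takes
    [A :\: B] for a basis [B] that extends a basis of [~: A]. The additive form avoids truncated
    subtraction. *)
Lemma rank_dual (T : finType) (M : matroid T) (A : {set T}) :
  rank (dual M) A + rank M setT = #|A| + rank M (~: A).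
Proof.
have card_basisT B : basis M B -> #|B| = rank M setT.
  move=> bB; apply/eqP; rewrite eqn_leq rank_geq ?subsetT ?basis_indep //=.
  by apply: rank_leq => I iI _; apply: leq_card_basis iI bB.
apply/eqP; rewrite eqn_leq; apply/andP; split.
  have [I [/coindepP[B bB dBI] sI <-]] := rank_witness (dual M) A.
  have leC : #|B :\: A| <= rank M (~: A).
    rewrite rank_geq ?setDE ?subsetIr // (indepS _ (basis_indep bB)) //.
    exact: subsetIl.
  have leI : #|I :|: (B :&: A)| <= #|A|.
    by rewrite subset_leq_card // subUset sI subsetIr.
  have := cardsUI I (B :&: A).
  rewrite setIA [I :&: B]setIC (eqP (_ : _ :&: I == set0)) ?setI_eq0 //.
  by rewrite set0I cards0 -(card_basisT B bB) -(cardsID A B); lia.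
have [J [iJ sJ cJ]] := rank_witness M (~: A).
have [B bB sJB] := basis_exists iJ.
have iAB : indep (dual M) (A :\: B).
  by apply/coindepP; exists B; rewrite // -setI_eq0 setDE setICA setICr setI0.
have leAB := rank_geq iAB (subsetDl A B).
have leJ : #|J| <= #|B :\: A| by rewrite subset_leq_card // setDE subsetI sJB.
move: leAB leJ; rewrite -(card_basisT B bB) -(cardsID A B) -(cardsID B A).
by rewrite [B :&: A]setIC; lia.
Qed.

(** By the dual rank formula, deleting [x] from [F] keeps the dual rank exactly when adding [x] to
    [~: F] raises the rank. Hence complementation swaps flatness and cyclicity. *)
Lemma cyclic_flats_dual (T : finType) (M : matroid T) (F : {set T}) :
  F \in cyclic_flats (dual M) -> ~: F \in cyclic_flats M.
Proof.
rewrite 2!inE => /andP[/flatP flatF /cyclicP cycF]; apply/andP; split.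
  apply/flatP => x eqx; rewrite inE; apply/negP => xF.
  have := rank_dual M F; have := rank_dual M (F :\ x).
  by rewrite setCD setUC eqx cycF // (cardsD1 x F) xF; lia.
apply/cyclicP => x; rewrite inE => xF.
have := rank_dual M F; have := rank_dual M (x |: F).
rewrite setCU setIC -setDE cardsU1 xF.
have := rank_setU1 (dual M) x F.
have : rank (dual M) F < rank (dual M) (x |: F).
  rewrite ltn_neqAle rank_sub ?subsetU1 // andbT.
  by apply: contraNneq xF => eqF; apply: flatF.
by lia.
Qed.

(** Complementation is injective and reverses inclusion, so it carries antichains to antichains. *)
Lemma cyclic_width_dual (T : finType) (M : matroid T) :
  cyclic_width (dual M) <= cyclic_width M.
Proof.
apply/bigmax_leqP => S /andP[/subsetP sS /forall_inP aS].
rewrite -(card_imset S (@setC_inj T)).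
apply: (@leq_bigmax_cond _ _ (fun S : {set {set T}} => #|S|)).
apply/andP; split.
  by apply/subsetP => _ /imsetP[F /sS FS ->]; apply: cyclic_flats_dual.
apply/forall_inP => _ /imsetP[F FS ->]; apply/forall_inP => _ /imsetP[G GS ->].
rewrite setCS; apply/implyP => sGF; apply/eqP; congr (~: _).
by have /forall_inP/(_ F FS)/implyP/(_ sGF)/eqP-> := aS G GS.
Qed.

(** * The presentation *)

Section Width2.

Variables (T : finType) (M : matroid T).
Hypothesis width2 : cyclic_width M <= 2.
Implicit Types (F G H I J X Y : {set T}) (U V : {set {set T}}).

(** The minimal members of [V] form an antichain of cyclic flats, so there are at most two. If there
    is only one, [G] and [H] coincide. *)
Lemma two_minimal V : V \subset cyclic_flats M -> V != set0 ->
  exists G H, [/\ G \in V, H \in V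
    & {in V, forall Y, (G \subset Y) || (H \subset Y)}].
Proof.
move=> sV /set0Pn[Y0 Y0V]; pose W := [set Y | minset (mem V) Y].
have WV Y : Y \in W -> Y \in V by rewrite inE => /minsetp.
have below Y : Y \in V -> exists2 G, G \in W & G \subset Y.
  by case/(@minset_exists _ (mem V) Y) => G mG sGY; exists G; rewrite ?inE.
have W2 : #|W| <= 2.
  apply: leq_trans width2.
  apply: (@leq_bigmax_cond _ _ (fun S : {set {set T}} => #|S|)).
  apply/andP; split.
    by apply/subsetP => Y /WV; apply: subsetP.
  apply/forall_inP => F /WV FV; apply/forall_inP => G.
  rewrite inE => mG; apply/implyP => sFG; apply/eqP.
  exact: minsetinf mG FV sFG.
have [G GW _] := below Y0 Y0V.
have [W1|[H]] := set_0Vmem (W :\ G).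
  exists G, G; split; try exact: WV.
  move=> Y /below[K KW sKY]; rewrite orbb.
  have [<- //|neqKG] := eqVneq K G.
  by have := in_set0 K; rewrite -W1 in_setD1 neqKG KW.
move=> HW; have [neqHG HW'] := setD1P HW.
exists G, H; split; try exact: WV.
move=> Y /below[K KW sKY]; apply/orP.
have [<-|neqKG] := eqVneq K G; first by left.
have [<-|neqKH] := eqVneq K H; first by right.
move: W2; rewrite (cardsD1 G) GW (cardsD1 H) HW (cardsD1 K).
by rewrite !in_setD1 neqKG neqKH KW.
Qed.

(** Stated for an up-closed [U] so that it serves both the partly built list and the complete
    one. *)
Lemma count_supersets U (s : seq {set T}) J :
    U \subset cyclic_flats M ->
    {in U & cyclic_flats M, forall F G, F \subset G -> G \in U} ->
    {subset s <= U} ->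
    {in U, forall F, count (fun Y => F \subset Y) s + rank M F = rank M setT} ->
  count (fun Y => J \subset Y) s + rank M J <= rank M setT.
Proof.
move=> sU upU sub_sU countU; pose V := [set Y in U | J \subset Y].
have [V0|Vn0] := eqVneq V set0.
  rewrite (eq_in_count (a2 := pred0)) ?count_pred0 ?rank_sub // => Y /sub_sU YU.
  by have := in_set0 Y; rewrite -V0 inE YU.
have sV : V \subset cyclic_flats M.
  by apply/subsetP => Y; rewrite inE => /andP[/(subsetP sU)].
have [G [H [GV HV coverV]]] := two_minimal sV Vn0.
have /setIdP[GU sJG] := GV; have /setIdP[HU sJH] := HV.
(* The join of [G] and [H]: the entries are flats, so those containing both are those containing
   [K], and [K] has the rank of [G :|: H]. *)
pose K := closure M (G :|: H).
have KU : K \in U.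
  apply: (upU G) => //; first by apply: cyclic_flats_join; apply: (subsetP sU).
  exact: subset_trans (subsetUl G H) (sub_closure _ _).
pose above X := fun Y => X \subset Y.
have leU : count (above J) s <= count (predU (above G) (above H)) s.
  elim: (s) sub_sU => //= Y s' IHs sub_sU.
  rewrite leq_add ?IHs // => [|Z Zs]; last by rewrite sub_sU ?inE ?Zs ?orbT.
  have [sJY|//] := boolP (above J Y); rewrite /above coverV //.
  by rewrite inE sub_sU ?mem_head.
have eqI : count (predI (above G) (above H)) s = count (above K) s.
  apply: eq_in_count => Y /sub_sU/(subsetP sU); rewrite inE => /andP[flatY _].
  by rewrite /= /above /K closure_sub // subUset.
have := count_predUI (above G) (above H) s; rewrite eqI.
have := countU G GU; have := countU H HU; have := countU K KU.
rewrite rank_closure -!/(above _); have := rank_submod M G H.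
have : rank M J <= rank M (G :&: H) by rewrite rank_sub // subsetI sJG.
move: leU; rewrite /above; lia.
Qed.

(** Induction on the size of [U]: a minimal [F] is removed, and copies of it are put in front of the
    list for the rest. By minimality they affect no other count. *)
Lemma exists_presentation U :
    U \subset cyclic_flats M ->
    {in U & cyclic_flats M, forall F G, F \subset G -> G \in U} ->
  exists2 s : seq {set T}, {subset s <= U}
    & {in U, forall F, count (fun Y => F \subset Y) s + rank M F = rank M setT}.
Proof.
have [n] := ubnP #|U|; elim: n U => // n IHn U ltUn sU upU.
have [->|/set0Pn[F0 F0U]] := eqVneq U set0.
  by exists [::] => // F; rewrite inE.
have [F mF _] := @minset_exists _ (mem U) F0 F0U.
have FU : F \in U := minsetp mF.
have minF G : G \in U -> G \subset F -> G = F.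
  by move=> GU sGF; apply: minsetinf mF GU sGF.
have [||G H /setD1P[neqGF GU] HM sGH|s sub_sU countU] := IHn (U :\ F).
- by rewrite [#|U|](cardsD1 F) FU in ltUn.
- exact: subset_trans (subsetDl _ _) sU.
- rewrite in_setD1 (upU G) // andbT; apply: contraNneq neqGF => eqHF.
  by apply/eqP/minF; rewrite // -eqHF.
have leF : count (fun Y => F \subset Y) s + rank M F <= rank M setT.
  apply: (@count_supersets (U :\ F)) => //.
    exact: subset_trans (subsetDl _ _) sU.
  move=> G H /setD1P[neqGF GU] HM sGH.
  rewrite in_setD1 (upU G) // andbT; apply: contraNneq neqGF => eqHF.
  by apply/eqP/minF; rewrite // -eqHF.
(* The number of copies of [F] still missing; by [leF] the subtraction is exact. *)
pose m := rank M setT - (count (fun Y => F \subset Y) s + rank M F).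
exists (nseq m F ++ s) => [Y|G GU].
  rewrite mem_cat mem_nseq => /orP[/andP[_ /eqP-> //]|/sub_sU].
  by rewrite inE => /andP[].
rewrite count_cat count_nseq; have [->|neqGF] := eqVneq G F.
  by rewrite subxx mul1n /m; lia.
have [/(minF G GU)/eqP|_] := boolP (G \subset F).
  by rewrite (negPf neqGF).
by rewrite countU // in_setD1 neqGF.
Qed.

Lemma cyclic_width2_transversal : transversal_matroid M.
Proof.
have upZ : {in cyclic_flats M & cyclic_flats M,
    forall F G, F \subset G -> G \in cyclic_flats M} by [].
have [s sub_s count_s] := exists_presentation (subxx _) upZ.
pose A (i : 'I_(size s)) := ~: tnth (in_tuple s) i.
(* The indices of the presenting sets that intersect [J]; the remaining indices are those of the
   entries containing [J]. *)
pose meet J := [set i | ~~ (J \subset ~: A i)].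
have card_meet J : #|meet J| + count (fun Y => J \subset Y) s = size s.
  rewrite -[RHS](count_predC (fun Y => J \subset Y) s) addnC; congr (_ + _).
  rewrite -sum1_count big_tnth sum1_card; apply: eq_card => i.
  by rewrite inE /A setCK.
(* The closure of [set0] is a cyclic flat of rank 0 contained in every entry, so its count is the
   whole length. *)
have size_s : size s = rank M setT.
  have /count_s : closure M set0 \in cyclic_flats M.
    by apply: cyclic_closure => x; rewrite inE.
  rewrite (@eq_in_count _ _ predT) => [|Y /sub_s]; last first.
    by rewrite inE => /andP[/closure_sub-> _]; rewrite sub0set.
  by rewrite count_predT rank_closure (indep_rank (indep0 M)) cards0 addn0.
exists (size s), A => X; split=> [iX|[f injf fA]]; last first.
  (* A circuit [C] inside a matched set would meet at least [#|C|] presenting sets, but the count at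
     its closure leaves only [rank M C], one fewer. *)
  apply/negPn/negP => /dependent_circuit[C cC sCX].
  have CM := circuit_closure cC.
  pose D := [set u : {x | x \in X} | val u \in C].
  have cD : #|C| = #|f @: D|.
    rewrite (card_imset _ injf) -(card_imset _ val_inj).
    apply: eq_card => x; apply/idP/imsetP => [xC|[u]].
      by exists (Sub x (subsetP sCX x xC)); rewrite ?inE.
    by rewrite inE => uC ->.
  have meetC : #|meet C| = rank M C.
    apply/(@addIn (count (fun Y => C \subset Y) s)); rewrite card_meet size_s.
    rewrite -(count_s _ CM) rank_closure addnC; congr (_ + _).
    apply: eq_in_count => Y /sub_s.
    by rewrite inE => /andP[/closure_sub->].
  have : #|f @: D| <= #|meet C|.
    apply/subset_leq_card/subsetP => i /imsetP[u].
    rewrite inE => uC ->; rewrite inE; apply/subsetPn; exists (val u) => //.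
    by rewrite inE negbK fA.
  by rewrite meetC -cD (circuit_rank cC) ltnn.
have hall J : J \subset X -> #|J| <= #|meet J|.
  move=> sJX; rewrite -(leq_add2r (count (fun Y => J \subset Y) s)).
  rewrite card_meet size_s addnC -(indep_rank (indepS sJX iX)).
  exact: count_supersets (subxx _) upZ sub_s count_s.
(* The empty set is treated apart, since the index type may be empty and [hall_marriage] needs an
   index [i0]. *)
have [X0|[x0 x0X]] := set_0Vmem X.
  have noX (u : {x | x \in X}) : False.
    by case: u => x; rewrite X0 inE.
  by exists (fun u => False_rect _ (noX u)) => [u|u]; case: (noX u).
have [i0 _] : exists i, i \in meet X.
  by apply/card_gt0P/(leq_trans _ (hall X (subxx X)))/card_gt0P; exists x0.
have [|f fA injf] := @hall_marriage _ _ i0 X (fun x => [set i | x \in A i]).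
  move=> J /hall/leq_trans; apply; apply/subset_leq_card/subsetP => i.
  rewrite inE => /subsetPn[x xJ]; rewrite inE negbK => xA.
  by apply/bigcupP; exists x; rewrite // in_set.
exists (fun u => f (val u)) => [u v|u].
  by move/(injf _ _ (valP u) (valP v))/val_inj.
by have := fA _ (valP u); rewrite inE.
Qed.

End Width2.

Theorem theorem5p6 (T : finType) (M : matroid T) :
  cyclic_width M <= 2 -> bitransversal M.
Proof.
move=> width2; split; apply: cyclic_width2_transversal => //.
exact: leq_trans (cyclic_width_dual M) width2.
Qed.
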